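(* Let $A\in\mathcal{M}_{t\times\infty}(S_{>0})$ be a nondegenerate regular array. Then the associated weight ideal $I_A$ is finitely generated as a two-sided ideal of $R=k\langle x_1,\dots,x_t\rangle$.
   Context: Let $k$ be a field, $t\ge 1$, and $R=k\langle x_1,\dots,x_t\rangle$ the free associative algebra. Let $\mathcal{B}^{\times}$ be the set of nontrivial (nonempty) words in $x_1,\dots,x_t$; $|\omega|$ is the length of a word $\omega$. Let $S_{>0}$ be the set of positive elements of a totally ordered field and $\mathcal{M}_{t\times\infty}(S_{>0})$ the set of $t\times\infty$ arrays $A=(a_{i,j})$, $1\le i\le t$, $j\ge 0$ (columns are indexed starting from $0$), with entries in $S_{>0}$. The weight function of $A$ is $\sigma(x_{u_0}x_{u_1}\cdots x_{u_{l-1}})=\prod_{j=0}^{l-1}a_{u_j,j}$. The weight ideal $I_A$ is the two-sided ideal of $R$ generated by all differences $\omega_1-\omega_2$ with $\omega_1,\omega_2\in\mathcal{B}^{\times}$, $|\omega_1|=|\omega_2|$ and $\sigma(\omega_1)=\sigma(\omega_2)$. $A$ is nondegenerate if $\sigma(x_i)\ne\sigma(x_j)$ for all $i\neq j$. $A$ is regular if it has rank $1$ (every column is a scalar multiple of the first column). *)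

(* Defs.v *)
From HB Require Import structures.
From mathcomp Require Import all_boot all_order all_algebra.
From mathcomp Require Export monalg.

Set Implicit Arguments.
Unset Strict Implicit.
Unset Printing Implicit Defensive.

Import Order.TTheory GRing.Theory Num.Theory.
Local Open Scope ring_scope.

Section TwoSidedIdeals.
Variable R : pzRingType.
Implicit Types (I J S : R -> Prop).

Definition two_sided_ideal J : Prop :=
  [/\ J 0,
      forall x y, J x -> J y -> J (x - y),
      forall a x, J x -> J (a * x)
    & forall x a, J x -> J (x * a)].

Definition generated_ideal S : R -> Prop :=
  fun x => forall J, two_sided_ideal J -> (forall y, S y -> J y) -> J x.

Definition finitely_generated_ideal I : Prop :=
  exists gs : seq R, forall x, I x <-> generated_ideal (fun y => y \in gs) x.

End TwoSidedIdeals.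

(* The monoid algebra of the free monoid on 'I_t is the free associative
   algebra; << w >> is the basis element attached to the word w, the empty
   word giving 1. *)
Notation word t := {fmonom 'I_t}.
Notation free_algebra k t := {malg k[word t]}.

Section WeightIdeals.
Variables (F : realFieldType) (t : nat) (A : 'I_t -> nat -> F).

Definition positive_array : Prop := forall i j, 0 < A i j.

Definition weight (w : word t) : F :=
  \prod_(j < size w) A (tnth (in_tuple w) j) j.

Definition nondegenerate_array : Prop :=
  forall i j : 'I_t, i != j -> weight (fmu i) != weight (fmu j).

Definition regular_array : Prop :=
  forall j, exists c : F, forall i, A i j = c * A i 0%N.

Definition weight_relation (k : fieldType) (g : free_algebra k t) : Prop :=
  exists w1 w2 : word t,
    [/\ (0 < size w1)%N, (0 < size w2)%N, size w1 = size w2,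
        weight w1 = weight w2
      & g = << w1 >> - << w2 >>].

Definition weight_ideal (k : fieldType) : free_algebra k t -> Prop :=
  generated_ideal (@weight_relation k).

End WeightIdeals.

Arguments weight_ideal {F t} A k _.

(* Main.v *)
(** The columns of a regular array are proportional, so two words of equal
    length have equal weight exactly when the products of their first-column
    entries agree.  On words this is a cancellative congruence that contains all
    commutations, hence comes from a congruence on the monoid of exponent vectors
    [N^t].  By Dickson's lemma finitely many pairs of nonempty related words are
    minimal for the componentwise order on pairs of exponent vectors; cancelling
    a minimal pair from a related pair leaves a shorter related pair, so by
    induction on length the commutations and the minimal pairs generate the
    congruence, and their differences generate the ideal. *)

Require Import Defs.
From mathcomp Require Import all_boot all_order all_algebra.
From Stdlib Require Import Classical.

Set Implicit Arguments.
Unset Strict Implicit.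
Unset Printing Implicit Defensive.

Import Order.TTheory GRing.Theory Num.Theory.
Local Open Scope ring_scope.

(** Induction on the coordinates. Let [M] dominate for the tail [s]: a point whose [f i] is at least
    the maximum of [f i] over [M] is dominated by [M] in coordinate [i] too. Below that maximum only
    finitely many levels [f i x = N] remain, each an instance for [s]. *)
Lemma dickson (X I : eqType) (f : I -> X -> nat) (s : seq I) (P : X -> Prop) :
  exists L : seq X, {in L, forall y, P y} /\
    forall x, P x -> exists2 y, y \in L & {in s, forall i, (f i y <= f i x)%N}.
Proof.
elim: s P => [|i s IHs] P.
  have [[x Px]|noP] := classic (exists x, P x); last first.
    by exists [::]; split=> // x Px; case: noP; exists x.
  by exists [:: x]; split=> [y /[1!inE] /eqP->|y _] //; exists x; rewrite ?inE.
have [M [PM domM]] := IHs P.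
have bounded N : exists L : seq X, {in L, forall y, P y} /\
    forall x, P x -> (f i x < N)%N ->
    exists2 y, y \in L & {in i :: s, forall j, (f j y <= f j x)%N}.
  elim: N => [|N [L [PL domL]]]; first by exists [::].
  have [L' [PL' domL']] := IHs (fun x => P x /\ f i x = N).
  exists (L ++ L'); split=> [y|x Px].
    by rewrite mem_cat => /orP[/PL|/PL'[]].
  rewrite ltnS leq_eqVlt => /predU1P[fxN|/(domL x Px)[y Ly le_yx]].
    have [//|y L'y le_yx] := domL' x; exists y; first by rewrite mem_cat L'y orbT.
    move=> j /[1!inE] /predU1P[->|/le_yx//].
    by rewrite fxN; have [_ ->] := PL' _ L'y.
  by exists y; rewrite ?mem_cat ?Ly.
have [L [PL domL]] := bounded (\max_(y <- M) f i y)%N.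
exists (M ++ L); split=> [y|x Px].
  by rewrite mem_cat => /orP[/PM|/PL].
have [/(domL x Px)[y Ly le_yx]|le_max] := ltnP (f i x) (\max_(y <- M) f i y)%N.
  by exists y; rewrite // mem_cat Ly orbT.
have [y My le_yx] := domM x Px; exists y; first by rewrite mem_cat My.
move=> j /[1!inE] /predU1P[->|/le_yx//].
by apply: leq_trans le_max; exact: (leq_bigmax_seq (P := xpredT) (F := f i) y).
Qed.

Definition word_congruence (T : Type) (E : seq T -> seq T -> Prop) : Prop :=
  [/\ forall s, E s s,
      forall s1 s2, E s1 s2 -> E s2 s1,
      forall s1 s2 s3, E s1 s2 -> E s2 s3 -> E s1 s3
    & forall s1 s2 u1 u2, E s1 s2 -> E u1 u2 -> E (s1 ++ u1) (s2 ++ u2)].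

(** The head letter of the first word occurs in the second; commuting it past the prefix [p] brings
    it to the front, and induction compares the tails. *)
Lemma word_congruence_perm (T : eqType) (E : seq T -> seq T -> Prop) :
    word_congruence E -> (forall a b, E [:: a; b] [:: b; a]) ->
  forall s1 s2, perm_eq s1 s2 -> E s1 s2.
Proof.
move=> [Exx Esym Etr Ecat] Ecomm.
have Emove x p q : E (x :: p ++ q) (p ++ x :: q).
  elim: p => [|y p IHp] /=; first exact: Exx.
  apply: Etr (Ecat [:: y] [:: y] _ _ (Exx _) IHp).
  exact: (Ecat [:: x; y] [:: y; x]).
elim=> [|x s1 IHs] s2; first by rewrite perm_sym => /perm_nilP ->.
move=> eq_s12; have s2x: x \in s2 by rewrite -(perm_mem eq_s12) mem_head.
case/splitPr: s2 / s2x eq_s12 => p q eq_s12.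
apply: Etr (Emove x p q); apply: (Ecat [:: x] [:: x]) => //.
apply: IHs; rewrite -(perm_cons x) (perm_trans eq_s12) //.
by rewrite perm_catC /= perm_cons perm_catC.
Qed.

Lemma cancellative_congruence_fg (T : finType) (P : seq T -> seq T -> Prop) :
    word_congruence P -> (forall s1 s2, P s1 s2 -> size s1 = size s2) ->
    (forall s1 s2, perm_eq s1 s2 -> P s1 s2) ->
    (forall s1 s2 u1 u2, P s1 s2 -> P (s1 ++ u1) (s2 ++ u2) -> P u1 u2) ->
  exists L : seq (seq T * seq T),
    {in L, forall p, (0 < size p.1)%N /\ P p.1 p.2} /\
    forall E, word_congruence E -> {in L, forall p, E p.1 p.2} ->
    forall s1 s2, P s1 s2 -> E s1 s2.
Proof.
move=> [_ Psym Ptr _] Psize Pperm Pcancel.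
(* The boolean selects a component of the pair, so one use of [dickson] compares both exponent
   vectors at once. *)
pose f (i : bool * T) (p : seq T * seq T) :=
  count_mem i.2 (if i.1 then p.1 else p.2).
have [L [PL domL]] := dickson f (enum [set: bool * T])
  (fun p : seq T * seq T => (0 < size p.1)%N /\ P p.1 p.2).
pose comms := [seq ([:: a; b], [:: b; a]) | a <- enum T, b <- enum T].
exists (comms ++ L); split=> [p|E Econg EL].
  rewrite mem_cat => /orP[/allpairsP[[a b] [_ _ ->]] /=|/PL//].
  by split=> //; apply/Pperm/permPl/(perm_catC [:: a] [:: b]).
have Eperm: forall s1 s2, perm_eq s1 s2 -> E s1 s2.
  apply: word_congruence_perm => // a b.
  apply: (EL ([:: a; b], [:: b; a])); rewrite mem_cat; apply/orP; left.
  by apply/allpairsP; exists (a, b); rewrite !mem_enum.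
have [Exx Esym Etr Ecat] := Econg.
move=> s1; have [n] := ubnP (size s1).
elim: n s1 => // n IHn s1 /ltnSE-le_s1n s2 Ps12.
have [s1_0|s1_gt0] := posnP (size s1).
  by rewrite (size0nil s1_0) (size0nil (etrans (esym (Psize _ _ Ps12)) s1_0)).
have [//|[u1 u2] Lu le_u] := domL (s1, s2).
have [/= u1_gt0 Pu12] := PL _ Lu.
(* Since exponents of [u1], [u2] are bounded by those of [s1], [s2], each splits off up to
   reordering, leaving a complement [v]. *)
have split_off b : exists v, perm_eq (if b then s1 else s2)
                            ((if b then u1 else u2) ++ v).
  have [|s sub_s eq_us] := (count_subseqP (if b then u1 else u2)
                              (if b then s1 else s2)).1.
    by move=> x; apply: (le_u (b, x)); rewrite mem_enum inE.
  have [v eq_sv] := perm_to_subseq sub_s; exists v.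
  by rewrite (permPl eq_sv) perm_cat2r perm_sym.
have [v1 /= eq_s1] := split_off true; have [v2 /= eq_s2] := split_off false.
have Pv12: P v1 v2.
  apply: Pcancel Pu12 _; apply: Ptr (Ptr _ _ _ Ps12 _); last exact: Pperm.
  by apply: Pperm; rewrite perm_sym.
apply: (Etr _ _ _ (Eperm _ _ eq_s1)); apply: Etr (Esym _ _ (Eperm _ _ eq_s2)).
apply: Ecat; first by apply: (EL (u1, u2)); rewrite mem_cat Lu orbT.
(* [u1] is nonempty, so [v1] is strictly shorter than [s1]. *)
apply: IHn Pv12; apply: leq_trans le_s1n.
by rewrite (perm_size eq_s1) size_cat -[ltnLHS]add0n ltn_add2r.
Qed.

Lemma two_sided_ideal_generated (R : pzRingType) (S : R -> Prop) :
  two_sided_ideal (generated_ideal S).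
Proof.
split=> [J [] //|x y Sx Sy J JI SJ|a x Sx J JI SJ|x a Sx J JI SJ];
  have [_ JB Jl Jr] := JI.
- by apply: JB; [apply: Sx|apply: Sy].
- by apply: Jl; apply: Sx.
- by apply: Jr; apply: Sx.
Qed.

Lemma mem_generated_ideal (R : pzRingType) (S : R -> Prop) x :
  S x -> generated_ideal S x.
Proof. by move=> Sx J _; apply. Qed.

(** Compatibility with concatenation is the telescoping [a * b - c * d = (a - c) * b + c * (b -
    d)]. *)
Lemma word_congruence_ideal (R : pzRingType) (J : R -> Prop) (T : Type)
    (phi : seq T -> R) :
    two_sided_ideal J -> (forall s u, phi (s ++ u) = phi s * phi u) ->
  word_congruence (fun s1 s2 => J (phi s1 - phi s2)).
Proof.
move=> [J0 JB Jl Jr] phiM.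
have JN x : J x -> J (- x) by move=> Jx; rewrite -sub0r; apply: JB.
have JD x y : J x -> J y -> J (x + y).
  by move=> Jx Jy; rewrite -[y]opprK; apply: JB => //; apply: JN.
split=> [s|s1 s2 J12|s1 s2 s3 J12 J23|s1 s2 u1 u2 Js Ju].
- by rewrite subrr.
- by rewrite -opprB; apply: JN.
- by rewrite -(subrKA (phi s2)); apply: JD.
rewrite !phiM -(subrKA (phi s2 * phi u1)) -mulrBl -mulrBr.
by apply: JD; [apply: Jr|apply: Jl].
Qed.

Definition monomial (k : fieldType) (t : nat) (s : seq 'I_t) :
  free_algebra k t := mkmalgU (FMonom s) 1.

Lemma monomial_cat (k : fieldType) (t : nat) (s u : seq 'I_t) :
  monomial k (s ++ u) = monomial k s * monomial k u.
Proof.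
rewrite /monomial malgM_def fgmulUU mulr1; congr (mkmalgU _ _).
by apply/val_inj; rewrite /= fmM.
Qed.

(** The scalar of column [j] can be read off any row [i0] as [A i0 j / A i0 0]; hence the first
    factor depends only on the length of [w]. *)
Lemma regular_weightE (F : realFieldType) (t : nat) (A : 'I_t -> nat -> F)
    (i0 : 'I_t) : positive_array A -> regular_array A ->
  forall w : word t, weight A w =
    (\prod_(j < size w) (A i0 j / A i0 0%N)) * \prod_(i <- w) A i 0%N.
Proof.
move=> A_pos A_reg w; rewrite (big_tnth _ _ w) -big_split /=.
apply: eq_bigr => j _; have [c Ac] := A_reg j.
by rewrite !Ac mulfK // gt_eqF.
Qed.

Theorem theorem21 (k : fieldType) (F : realFieldType) (t : nat)
    (A : 'I_t -> nat -> F) (t_ge1 : (1 <= t)%N) (A_pos : positive_array A)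
    (A_nondeg : nondegenerate_array A) (A_reg : regular_array A) :
  finitely_generated_ideal (weight_ideal A k).
Proof.
pose i0 := Ordinal t_ge1.
pose val (s : seq 'I_t) := \prod_(i <- s) A i 0%N.
have val_neq0 s : val s != 0 by rewrite gt_eqF // prodr_gt0.
have eq_weight (w1 w2 : word t) : size w1 = size w2 ->
    weight A w1 = weight A w2 <-> val w1 = val w2.
  move=> eq_sz; rewrite !(regular_weightE i0) // eq_sz.
  split; last by rewrite /val => ->.
  apply: mulfI.
  by rewrite gt_eqF // prodr_gt0 // => j _; rewrite divr_gt0.
pose P s1 s2 := size s1 = size s2 /\ val s1 = val s2.
have val_cat s u : val (s ++ u) = val s * val u by rewrite /val big_cat.
have [||||L [PL genL]] := @cancellative_congruence_fg _ P.
- split=> // [s1 s2 [] //|s1 s2 s3|s1 s2 u1 u2 [zs vs] [zu vu]].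
    by rewrite /P => -[-> ->].
  by split; rewrite ?size_cat ?val_cat ?zs ?zu ?vs ?vu.
- by move=> s1 s2 [].
- by move=> s1 s2 eq_s; split; [apply: perm_size|apply: perm_big].
- move=> s1 s2 u1 u2 [zs vs] []; rewrite !size_cat !val_cat zs vs.
  by move/addnI=> zu /(mulfI (val_neq0 _)).
pose gens := [seq monomial k p.1 - monomial k p.2 | p <- L].
have gensE s1 s2 : P s1 s2 ->
    generated_ideal (fun y => y \in gens) (monomial k s1 - monomial k s2).
  (* The congruence [E] is taken to be equality of monomials modulo the ideal generated by
     [gens]. *)
  apply: genL (word_congruence_ideal _ _) _ s1 s2.
  - exact: two_sided_ideal_generated.
  - exact: monomial_cat.
  - by move=> p Lp; apply: mem_generated_ideal; apply/mapP; exists p.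
exists gens => x; split=> Ix.
  apply: Ix => [|_ [[s1] [[s2] [_ _ zs /(eq_weight _ _ zs) vs ->]]]].
    exact: two_sided_ideal_generated.
  exact: gensE.
apply: Ix => [|_ /mapP[p Lp ->]]; first exact: two_sided_ideal_generated.
have [p_gt0 [zp vp]] := PL p Lp; apply: mem_generated_ideal.
exists (FMonom p.1), (FMonom p.2); split=> //; first by rewrite /= -zp.
exact/eq_weight.
Qed.
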